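(* Let $A$ and $B$ be skew braces. If $A$ and $B$ are isoclinic, then $A$ is two-sided if and only if $B$ is two-sided.
   Context: A skew brace is a triple $(A,+,\circ)$ where $(A,+)$ and $(A,\circ)$ are groups (neither assumed commutative) with $a\circ(b+c)=a\circ b-a+a\circ c$ for all $a,b,c\in A$. The two groups share the identity $0$. Put $\lambda_a(b)=-a+a\circ b$, $a*b=-a+a\circ b-b$, $[a,b]_+=a+b-a-b$. The annihilator is $\operatorname{Ann}(A)=\ker\lambda\cap Z(A,+)\cap Z(A,\circ)$, an ideal of $A$, so that $A/\operatorname{Ann}(A)$ is a skew brace; $\overline{a}$ denotes the class of $a$. The commutator $A'$ of $A$ is the additive subgroup generated by all $[a,b]_+$ and all $a*b$, $a,b\in A$; it is an ideal of $A$ (in particular a sub skew brace). The values $[a,b]_+$ and $a*b$ depend only on the classes of $a,b$ modulo $\operatorname{Ann}(A)$. Skew braces $A$ and $B$ are isoclinic if there is an isoclinism $(\xi,\theta)$, i.e. skew brace isomorphisms $\xi\colon A/\operatorname{Ann}(A)\to B/\operatorname{Ann}(B)$ and $\theta\colon A'\to B'$ such that, whenever $a_1,a_2\in A$ and $b_1,b_2\in B$ satisfy $\xi(\overline{a_i})=\overline{b_i}$ for $i=1,2$, one has $\theta([a_1,a_2]_+)=[b_1,b_2]_+$ and $\theta(a_1*a_2)=b_1*b_2$. A skew brace $A$ is two-sided if $(a+b)\circ c=a\circ c-c+b\circ c$ for all $a,b,c\in A$. *)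

(* Defs.v *)
From HB Require Import structures.
Set Warnings "-notation-overridden".
Set Warnings "-redundant-canonical-projection".
Set Warnings "-projection-no-head-constant".
From mathcomp Require Import all_boot boolp.

Set Implicit Arguments.
Unset Strict Implicit.
Unset Printing Implicit Defensive.

Local Open Scope quotient_scope.

(* The circle group is the group law of groupType, written multiplicatively in
   the library; the additive group is given by the fields of the mixin, since
   the additive groups of the library are commutative. That the two groups have
   the same identity is a consequence (lemma bone). *)
HB.mixin Record isSkewBrace A of Group A := {
  badd : A -> A -> A;
  bzero : A;
  bopp : A -> A;
  baddA : associative badd;
  badd0 : left_id bzero badd;
  baddr0 : right_id bzero badd;
  baddN : left_inverse bzero bopp badd;
  baddrN : right_inverse bzero bopp badd;
  circ_badd : forall a b c : A,
    (a * badd b c = badd (badd (a * b) (bopp a)) (a * c))%g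
}.

#[short(type="skewBraceType")]
HB.structure Definition SkewBrace := {A of isSkewBrace A & Group A}.

Declare Scope brace_scope.
Delimit Scope brace_scope with brace.
Bind Scope brace_scope with SkewBrace.sort.

Notation "x + y" := (badd x y) : brace_scope.
Notation "- x" := (bopp x) : brace_scope.
Notation "x - y" := (badd x (bopp y)) : brace_scope.
Notation "0" := bzero : brace_scope.
Notation "x ∘ y" := (@monoid.mul _ x y)
  (at level 40, left associativity) : brace_scope.

Local Open Scope brace_scope.

Section BraceOps.
Variable A : skewBraceType.
Implicit Types a b c z w : A.

Definition lam a b : A := - a + a ∘ b.
(* a * b in the usual notation of skew braces *)
Definition star a b : A := - a + a ∘ b - b.
Definition addcomm a b : A := a + b - a - b.

Definition two_sided : Prop :=
  forall a b c, (a + b) ∘ c = a ∘ c - c + b ∘ c.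

Definition in_ann a : Prop :=
  [/\ forall b, lam a b = b,
      forall b, a + b = b + a
    & forall b, a ∘ b = b ∘ a].

Definition Ann : {pred A} := fun a => `[< in_ann a >].

Record add_subgroup (S : A -> Prop) : Prop := {
  add_subgroup0 : S 0;
  add_subgroupD : forall a b, S a -> S b -> S (a + b);
  add_subgroupN : forall a, S a -> S (- a)
}.

(* Membership in the additive subgroup generated by the [b, c]_+ and b * c *)
Definition in_derived a : Prop :=
  forall S : A -> Prop, add_subgroup S ->
    (forall b c, S (addcomm b c)) -> (forall b c, S (star b c)) -> S a.

Definition derived_pred : {pred A} := fun a => `[< in_derived a >].

Lemma baddKl a b : - a + (a + b) = b.
Proof. by rewrite baddA baddN badd0. Qed.

Lemma baddNKl a b : a + (- a + b) = b.
Proof. by rewrite baddA baddrN badd0. Qed.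

Lemma baddK a b : b + a - a = b.
Proof. by rewrite -baddA baddrN baddr0. Qed.

Lemma baddNK a b : b - a + a = b.
Proof. by rewrite -baddA baddN baddr0. Qed.

Lemma badd_injl a b c : a + b = a + c -> b = c.
Proof. by move=> e; rewrite -(baddKl a b) e baddKl. Qed.

Lemma boppK a : - - a = a.
Proof. by apply: (@badd_injl (- a)); rewrite baddrN baddN. Qed.

Lemma boppD a b : - (a + b) = - b - a.
Proof. by apply: (@badd_injl (a + b)); rewrite baddrN -baddA baddNKl baddrN. Qed.

Lemma circ0 a : a ∘ 0 = a.
Proof.
have := circ_badd a 0 0; rewrite badd0 -baddA => /(congr1 (fun x => - (a ∘ 0) + x)).
rewrite baddN baddKl => /(congr1 (fun x => a + x)).
by rewrite baddr0 baddNKl.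
Qed.

Lemma bone : (1 : A)%g = 0.
Proof. by rewrite -(circ0 1%g) mul1g. Qed.

Lemma circ_star a b : a ∘ b = a + star a b + b.
Proof. by rewrite /star !baddA baddrN badd0 baddNK. Qed.

Lemma annP a : reflect (in_ann a) (a \in Ann).
Proof. exact: asboolP. Qed.

Lemma derivedP a : reflect (in_derived a) (a \in derived_pred).
Proof. exact: asboolP. Qed.

Lemma ann_circ z a : in_ann z -> z ∘ a = z + a.
Proof. by case=> h _ _; rewrite -[in RHS](h a) baddNKl. Qed.

Lemma circ_ann a z : in_ann z -> a ∘ z = a + z.
Proof. by move=> hz; case: (hz) => _ h1 h2; rewrite -h2 ann_circ. Qed.

Lemma in_ann0 : in_ann 0.
Proof.
split=> b; first by rewrite /lam -bone mul1g bone -{1}(badd0 b) baddKl.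
- by rewrite badd0 baddr0.
- by rewrite -bone mul1g mulg1.
Qed.

Lemma in_annD z w : in_ann z -> in_ann w -> in_ann (z + w).
Proof.
move=> hz hw; have [z1 z2 z3] := hz; have [w1 w2 w3] := hw.
have e : z + w = z ∘ w by rewrite ann_circ.
split=> b.
- by rewrite /lam [in X in _ + X]e -mulgA !ann_circ // (baddA z w b) baddKl.
- by rewrite -baddA w2 baddA z2 baddA.
- by rewrite e -mulgA (w3 b) mulgA (z3 b) mulgA.
Qed.

Lemma in_ann_invE z : in_ann z -> (z^-1)%g = - z.
Proof.
move=> hz; apply: (@badd_injl z).
by rewrite -ann_circ // mulgV baddrN bone.
Qed.

Lemma in_annN z : in_ann z -> in_ann (- z).
Proof.
move=> hz; have [z1 z2 z3] := hz; have e := in_ann_invE hz.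
split=> b.
- apply: (@badd_injl (- z)); rewrite /lam baddNKl -e.
  by apply: (can_inj (mulKg z)); rewrite mulVKg (ann_circ _ hz) e baddNKl.
- by apply: (@badd_injl z); rewrite baddNKl baddA z2 baddK.
- by rewrite -e; apply: (can_inj (mulKg z)); rewrite mulVKg mulgA z3 mulgK.
Qed.

(* a ~ b when they have the same additive coset modulo Ann(A); the
   multiplicative cosets are the same sets (lemma circ_ann). *)
Definition ann_rel : rel A := fun a b => (- a + b) \in Ann.

Lemma ann_relP a b :
  reflect (exists2 z, in_ann z & b = a + z) (ann_rel a b).
Proof.
apply: (iffP idP) => [/annP h | [z hz ->]].
  by exists (- a + b) => //; rewrite baddNKl.
by apply/annP; rewrite baddKl.
Qed.

Lemma ann_rel_refl : reflexive ann_rel.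
Proof. by move=> a; apply/annP; rewrite baddN; apply: in_ann0. Qed.

Lemma ann_rel_sym : symmetric ann_rel.
Proof.
suff h a b : ann_rel a b -> ann_rel b a by move=> a b; apply/idP/idP; apply: h.
case/ann_relP=> z hz ->; apply/ann_relP; exists (- z); first exact: in_annN.
by rewrite baddK.
Qed.

Lemma ann_rel_trans : transitive ann_rel.
Proof.
move=> b a c /ann_relP[z hz ->] /ann_relP[w hw ->]; apply/ann_relP.
by exists (z + w); [apply: in_annD | rewrite baddA].
Qed.

Canonical ann_equiv := EquivRel ann_rel ann_rel_refl ann_rel_sym ann_rel_trans.

(* The quotient A / Ann(A). *)
Definition annQuot := {eq_quot ann_equiv}.

HB.instance Definition _ : EqQuotient A ann_equiv annQuot :=
  EqQuotient.on annQuot.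
HB.instance Definition _ := Choice.on annQuot.

Lemma annQuotP a b : reflect (\pi_annQuot a = \pi_annQuot b) (ann_rel a b).
Proof. by apply: (iffP idP) => /eqmodP. Qed.

Lemma repr_ann a : exists2 z, in_ann z & repr (\pi_annQuot a) = a + z.
Proof. by apply/ann_relP/annQuotP; rewrite reprK. Qed.

Definition q_add (x y : annQuot) : annQuot := \pi_annQuot (repr x + repr y).
Definition q_opp (x : annQuot) : annQuot := \pi_annQuot (- repr x).
Definition q_circ (x y : annQuot) : annQuot := \pi_annQuot (repr x ∘ repr y).
Definition q_inv (x : annQuot) : annQuot := \pi_annQuot ((repr x)^-1)%g.
Definition q_zero : annQuot := \pi_annQuot 0.
Definition q_one : annQuot := \pi_annQuot 1%g.

Lemma pi_addE a b : q_add (\pi_annQuot a) (\pi_annQuot b) = \pi_annQuot (a + b).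
Proof.
rewrite /q_add; have [z hz ->] := repr_ann a; have [w hw ->] := repr_ann b.
apply/annQuotP; rewrite ann_rel_sym; apply/ann_relP; exists (z + w).
  exact: in_annD.
by case: hz => _ h _; rewrite -!baddA [z + (b + w)]h -baddA -(h w).
Qed.

Lemma pi_oppE a : q_opp (\pi_annQuot a) = \pi_annQuot (- a).
Proof.
rewrite /q_opp; have [z hz ->] := repr_ann a; have hz' := in_annN hz.
apply/annQuotP; rewrite ann_rel_sym; apply/ann_relP; exists (- z) => //.
by rewrite boppD; case: hz' => _ h _.
Qed.

Lemma pi_circE a b : q_circ (\pi_annQuot a) (\pi_annQuot b) = \pi_annQuot (a ∘ b).
Proof.
rewrite /q_circ; have [z hz ->] := repr_ann a; have [w hw ->] := repr_ann b.
have hzw := in_annD hz hw.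
apply/annQuotP; rewrite ann_rel_sym; apply/ann_relP; exists (z + w) => //.
rewrite -(circ_ann a hz) -(circ_ann b hw) -(circ_ann _ hzw) -(circ_ann z hw).
by case: hz => _ _ h; rewrite !mulgA -(mulgA a z b) (h b) mulgA.
Qed.

Lemma pi_invE a : q_inv (\pi_annQuot a) = \pi_annQuot (a^-1)%g.
Proof.
rewrite /q_inv; have [z hz ->] := repr_ann a; have hz' := in_annN hz.
apply/annQuotP; rewrite ann_rel_sym; apply/ann_relP; exists (- z) => //.
rewrite -(circ_ann a hz) -(circ_ann _ hz') invgM (in_ann_invE hz).
by case: hz' => _ _ h; rewrite h.
Qed.

Lemma q_ind (P : annQuot -> Prop) :
  (forall a, P (\pi_annQuot a)) -> forall x, P x.
Proof. by move=> h x; rewrite -(reprK x). Qed.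

Lemma q_addA : associative q_add.
Proof.
by elim/q_ind=> a; elim/q_ind=> b; elim/q_ind=> c; rewrite !pi_addE baddA.
Qed.
Lemma q_add0 : left_id q_zero q_add.
Proof. by elim/q_ind=> a; rewrite pi_addE badd0. Qed.
Lemma q_addr0 : right_id q_zero q_add.
Proof. by elim/q_ind=> a; rewrite pi_addE baddr0. Qed.
Lemma q_addN : left_inverse q_zero q_opp q_add.
Proof. by elim/q_ind=> a; rewrite pi_oppE pi_addE baddN. Qed.
Lemma q_addrN : right_inverse q_zero q_opp q_add.
Proof. by elim/q_ind=> a; rewrite pi_oppE pi_addE baddrN. Qed.
Lemma q_circA : associative q_circ.
Proof.
by elim/q_ind=> a; elim/q_ind=> b; elim/q_ind=> c; rewrite !pi_circE mulgA.
Qed.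
Lemma q_circ1 : left_id q_one q_circ.
Proof. by elim/q_ind=> a; rewrite pi_circE mul1g. Qed.
Lemma q_circr1 : right_id q_one q_circ.
Proof. by elim/q_ind=> a; rewrite pi_circE mulg1. Qed.
Lemma q_circV : left_inverse q_one q_inv q_circ.
Proof. by elim/q_ind=> a; rewrite pi_invE pi_circE mulVg. Qed.
Lemma q_circrV : right_inverse q_one q_inv q_circ.
Proof. by elim/q_ind=> a; rewrite pi_invE pi_circE mulgV. Qed.

HB.instance Definition _ := isGroup.Build annQuot
  q_circA q_circ1 q_circr1 q_circV q_circrV.

Lemma q_circ_badd (x y z : annQuot) :
  q_circ x (q_add y z) = q_add (q_add (q_circ x y) (q_opp x)) (q_circ x z).
Proof.
elim/q_ind: x => a; elim/q_ind: y => b; elim/q_ind: z => c.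
by rewrite pi_oppE pi_addE !pi_circE !pi_addE circ_badd.
Qed.

HB.instance Definition _ := isSkewBrace.Build annQuot
  q_addA q_add0 q_addr0 q_addN q_addrN q_circ_badd.

Lemma pi_badd a b : \pi_annQuot (a + b) = \pi_annQuot a + \pi_annQuot b.
Proof. by rewrite -pi_addE. Qed.

Lemma pi_circ a b : \pi_annQuot (a ∘ b) = \pi_annQuot a ∘ \pi_annQuot b.
Proof. by rewrite -pi_circE. Qed.

Lemma derived_add_subgroup : add_subgroup in_derived.
Proof.
split=> [S hS _ _ | a b ha hb S hS h1 h2 | a ha S hS h1 h2].
- exact: add_subgroup0.
- by apply: add_subgroupD => //; [apply: ha | apply: hb].
- by apply: add_subgroupN => //; apply: ha.
Qed.

Lemma in_derived_addcomm a b : in_derived (addcomm a b).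
Proof. by move=> S _ h _; apply: h. Qed.

Lemma in_derived_star a b : in_derived (star a b).
Proof. by move=> S _ _ h; apply: h. Qed.

Lemma derived0 : 0 \in derived_pred.
Proof. by apply/derivedP; case: derived_add_subgroup. Qed.

Lemma derivedD a b :
  a \in derived_pred -> b \in derived_pred -> a + b \in derived_pred.
Proof.
by move=> /derivedP ha /derivedP hb; apply/derivedP;
  case: derived_add_subgroup => _ h _; apply: h.
Qed.

Lemma derivedN a : a \in derived_pred -> - a \in derived_pred.
Proof.
by move=> /derivedP ha; apply/derivedP; case: derived_add_subgroup => _ _; apply.
Qed.

Lemma derived_addcomm a b : addcomm a b \in derived_pred.
Proof. by apply/derivedP; apply: in_derived_addcomm. Qed.

Lemma derived_star a b : star a b \in derived_pred.
Proof. by apply/derivedP; apply: in_derived_star. Qed.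

Lemma derived_circ a b :
  a \in derived_pred -> b \in derived_pred -> a ∘ b \in derived_pred.
Proof. by move=> ha hb; rewrite circ_star (derivedD (derivedD ha (derived_star _ _)) hb). Qed.

Lemma derived_inv a : a \in derived_pred -> (a^-1)%g \in derived_pred.
Proof.
move=> ha; have -> : (a^-1)%g = - (a + star a a^-1%g).
  apply: (@badd_injl (a + star a a^-1%g)).
  by rewrite -circ_star baddrN mulgV bone.
exact: derivedN (derivedD ha (derived_star _ _)).
Qed.

Lemma derived_group_closed : group_closed derived_pred.
Proof.
split=> [|a b ha hb]; first by rewrite bone derived0.
by rewrite derived_circ // derived_inv.
Qed.

(* The commutator A' of A, a sub skew brace. *)
Definition derived := {a : A | a \in derived_pred}.

HB.instance Definition _ := SubChoice.on derived.
HB.instance Definition _ :=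
  SubChoice_isSubGroup.Build A derived_pred derived derived_group_closed.

Definition d_add (x y : derived) : derived :=
  exist _ (val x + val y) (derivedD (valP x) (valP y)).
Definition d_zero : derived := exist _ 0 derived0.
Definition d_opp (x : derived) : derived :=
  exist _ (- val x) (derivedN (valP x)).

Lemma d_addA : associative d_add.
Proof. by move=> x y z; apply: val_inj; rewrite /= baddA. Qed.
Lemma d_add0 : left_id d_zero d_add.
Proof. by move=> x; apply: val_inj; rewrite /= badd0. Qed.
Lemma d_addr0 : right_id d_zero d_add.
Proof. by move=> x; apply: val_inj; rewrite /= baddr0. Qed.
Lemma d_addN : left_inverse d_zero d_opp d_add.
Proof. by move=> x; apply: val_inj; rewrite /= baddN. Qed.
Lemma d_addrN : right_inverse d_zero d_opp d_add.
Proof. by move=> x; apply: val_inj; rewrite /= baddrN. Qed.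
Lemma d_circ_badd (x y z : derived) :
  x ∘ d_add y z = d_add (d_add (x ∘ y) (d_opp x)) (x ∘ z).
Proof. by apply: val_inj; exact: circ_badd. Qed.

HB.instance Definition _ := isSkewBrace.Build derived
  d_addA d_add0 d_addr0 d_addN d_addrN d_circ_badd.

Lemma val_badd (x y : derived) : val (x + y) = val x + val y.
Proof. by []. Qed.

Lemma val_circ (x y : derived) : val (x ∘ y) = val x ∘ val y.
Proof. by []. Qed.

(* [a, b]_+ and a * b as elements of A'. *)
Definition d_addcomm a b : derived :=
  exist _ (addcomm a b) (derived_addcomm a b).
Definition d_star a b : derived := exist _ (star a b) (derived_star a b).

End BraceOps.

Definition brace_iso (A B : skewBraceType) (f : A -> B) : Prop :=
  [/\ bijective f, {morph f : x y / x + y} & {morph f : x y / x ∘ y}].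

Definition isoclinism (A B : skewBraceType)
    (xi : annQuot A -> annQuot B) (theta : derived A -> derived B) : Prop :=
  [/\ brace_iso xi, brace_iso theta
    & forall (a1 a2 : A) (b1 b2 : B),
        xi (\pi_(annQuot A) a1) = \pi_(annQuot B) b1 ->
        xi (\pi_(annQuot A) a2) = \pi_(annQuot B) b2 ->
        theta (d_addcomm a1 a2) = d_addcomm b1 b2 /\
        theta (d_star a1 a2) = d_star b1 b2].

Definition isoclinic (A B : skewBraceType) : Prop :=
  exists (xi : annQuot A -> annQuot B) (theta : derived A -> derived B),
    isoclinism xi theta.

(* Main.v *)
(* Two-sidedness says (a + b) * c = - b + a * c + b + b * c. Writing the
   conjugate - b + x + b as x + [- x, - b]_+, this becomes an equation between
   elements of A' built from the values of * and [ , ]_+ alone, so that an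
   isoclinism carries it from corresponding triples of A to those of B. *)

From mathcomp Require Import all_boot.
Require Import Defs.

Set Implicit Arguments.
Unset Strict Implicit.
Unset Printing Implicit Defensive.

Local Open Scope quotient_scope.
Local Open Scope brace_scope.

(** Two-sidedness at a single triple: an isoclinism relates elements only through their classes, so
    the transfer is made triple by triple. *)
Definition right_distr (A : skewBraceType) (a b c : A) : Prop :=
  (a + b) ∘ c = a ∘ c - c + b ∘ c.

Lemma badd_injr (A : skewBraceType) (a b c : A) : b + a = c + a -> b = c.
Proof. by move=> e; rewrite -(baddK a b) e baddK. Qed.

Lemma conj_addcomm (A : skewBraceType) (x b : A) :
  x + addcomm (- x) (- b) = - b + x + b.
Proof. by rewrite /addcomm !boppK !baddA baddrN badd0. Qed.

Lemma right_distrE (A : skewBraceType) (a b c : A) :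
  right_distr a b c <->
  d_star (a + b) c
    = d_star a c + d_addcomm (- star a c) (- b) + d_star b c.
Proof.
have derivedE : val (d_star a c + d_addcomm (- star a c) (- b) + d_star b c)
    = - b + star a c + b + star b c by rewrite !val_badd /= conj_addcomm.
(* Expand each product by [circ_star]; the inner [c] cancels, and pulling [b] to the front
   conjugates [star a c] by it. Then [(a + b) ∘ c] has the same outer terms [a + b] and [c], which
   cancel. *)
have circE : a ∘ c - c + b ∘ c
    = a + b + (- b + star a c + b + star b c) + c.
  by rewrite !circ_star -!baddA !baddNKl.
rewrite /right_distr circE circ_star; split=> [e | /(congr1 val)].
  by apply: val_inj; rewrite derivedE; move: e => /badd_injr /badd_injl.
by rewrite derivedE /= => ->.
Qed.

Lemma badd_morphN (A B : skewBraceType) (f : A -> B) :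
  {morph f : x y / x + y} -> {morph f : x / - x}.
Proof.
move=> fD x; have f0 : f 0 = 0.
  by apply: (@badd_injl _ (f 0)); rewrite -fD !baddr0.
by apply: (@badd_injl _ (f x)); rewrite -fD !baddrN.
Qed.

Lemma brace_iso_star (A B : skewBraceType) (f : A -> B) :
  brace_iso f -> {morph f : x y / star x y}.
Proof. by case=> _ fD fM x y; rewrite /star !fD fM !(badd_morphN fD). Qed.

Lemma pi_bopp (A : skewBraceType) (a : A) :
  \pi_(annQuot A) (- a) = - \pi_(annQuot A) a.
Proof. by rewrite -pi_oppE. Qed.

Lemma pi_star (A : skewBraceType) (a b : A) :
  \pi_(annQuot A) (star a b) = star (\pi_(annQuot A) a) (\pi_(annQuot A) b).
Proof. by rewrite /star !pi_badd !pi_bopp pi_circ. Qed.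

Lemma isoclinism_right_distr (A B : skewBraceType)
    (xi : annQuot A -> annQuot B) (theta : derived A -> derived B)
    (a b c : A) (a' b' c' : B) :
  isoclinism xi theta ->
  xi (\pi_(annQuot A) a) = \pi_(annQuot B) a' ->
  xi (\pi_(annQuot A) b) = \pi_(annQuot B) b' ->
  xi (\pi_(annQuot A) c) = \pi_(annQuot B) c' ->
  right_distr a b c <-> right_distr a' b' c'.
Proof.
case=> xi_iso [/bij_inj theta_inj thetaD _] compat ea eb ec.
have [_ xiD _] := xi_iso.
have eab : xi (\pi_(annQuot A) (a + b)) = \pi_(annQuot B) (a' + b').
  by rewrite !pi_badd xiD ea eb.
have enb : xi (\pi_(annQuot A) (- b)) = \pi_(annQuot B) (- b').
  by rewrite !pi_bopp (badd_morphN xiD) eb.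
(* The first argument of the commutator is itself a value of [star]; its class is matched because
   [xi] preserves [star] on the quotients. *)
have ens : xi (\pi_(annQuot A) (- star a c)) = \pi_(annQuot B) (- star a' c').
  by rewrite !pi_bopp !pi_star (badd_morphN xiD) (brace_iso_star xi_iso) ea ec.
have [_ t_abc] := compat _ _ _ _ eab ec.
have [_ t_ac] := compat _ _ _ _ ea ec.
have [_ t_bc] := compat _ _ _ _ eb ec.
have [t_comm _] := compat _ _ _ _ ens enb.
(* The equation in B' is now the image under [theta] of the one in A'; injectivity of [theta] gives
   the converse. *)
rewrite !right_distrE -t_abc -t_ac -t_bc -t_comm -!thetaD.
by split=> [-> | /theta_inj].
Qed.

Theorem theorem3p12 (A B : skewBraceType) (hAB : isoclinic A B) :
  two_sided A <-> two_sided B.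
Proof.
have [xi [theta iso]] := hAB; have [[[xi' xiK xi'K] _ _] _ _] := iso.
split=> tw a b c.
  (* Each element of [B] gets a partner in [A]: a representative of the preimage of its class under
     [xi]. *)
  pose lift x := repr (xi' (\pi_(annQuot B) x)).
  have liftE x : xi (\pi_(annQuot A) (lift x)) = \pi_(annQuot B) x.
    by rewrite reprK xi'K.
  by apply/(isoclinism_right_distr iso (liftE a) (liftE b) (liftE c))/tw.
pose push x := repr (xi (\pi_(annQuot A) x)).
have pushE x : xi (\pi_(annQuot A) x) = \pi_(annQuot B) (push x).
  by rewrite reprK.
by apply/(isoclinism_right_distr iso (pushE a) (pushE b) (pushE c))/tw.
Qed.
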